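(* The minimax regret of the online ranking game under DCG, with feedback restricted to the relevance of the top ranked item, even when the adversary can play multi-graded relevance vectors (in $\{0,1,\dots,n\}^m$), is $\Theta(T^{2/3})$.
   Context: There are $m$ fixed items. A permutation $\sigma$ of the items $1,\dots,m$ maps ranks to items, and $\sigma^{-1}$ maps items to ranks; $\mathrm{DCG}(\sigma,R)=\sum_{i=1}^m\frac{2^{R(i)}-1}{\log_2(1+\sigma^{-1}(i))}$ (a gain) for a relevance vector $R\in\{0,1,\dots,n\}^m$. Online game over $T$ rounds with an oblivious adversary who generates $R_1,\dots,R_T\in\{0,1,\dots,n\}^m$: at round $t$ the learner outputs a permutation $\sigma_t$, possibly using internal randomization and based on the feedback received so far; it gains $\mathrm{DCG}(\sigma_t,R_t)$ but observes only $R_t(\sigma_t(1))$. The expected regret is $\max_\sigma\sum_{t=1}^T\mathrm{DCG}(\sigma,R_t)-\mathbb{E}\big[\sum_{t=1}^T\mathrm{DCG}(\sigma_t,R_t)\big]$. The worst-case regret of a learner strategy is its maximal expected regret over all choices of $R_1,\dots,R_T$; the minimax regret is the minimal worst-case regret over all learner strategies. The rate $\Theta(T^{2/3})$ refers to the dependence on $T$.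
   Formalization: The formal theorem assumes at least three items (m ≥ 3) and n ≥ 1; with m = 1 or n = 0 the regret is 0, and with m = 2 the game is a scaled two-armed bandit with regret of order √T, so the claimed rate fails there. *)

(* Defs.v *)
From HB Require Import structures.
From mathcomp Require Import all_boot all_order all_algebra all_fingroup.
From mathcomp Require Import all_classical all_reals all_analysis.

Set Implicit Arguments.
Unset Strict Implicit.
Unset Printing Implicit Defensive.

Import Order.TTheory GRing.Theory Num.Theory.
Import numFieldNormedType.Exports.

Local Open Scope classical_set_scope.
Local Open Scope ring_scope.

(* Items and ranks are both indexed from 0: a permutation [s] maps ranks to
   items, [s^-1] maps items to ranks, and the rank of item [i] in the usual
   numbering from 1 is [((s^-1)%g i).+1]. *)

Definition relevance (m n : nat) := {ffun 'I_m -> 'I_n.+1}.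

Definition log2 (R : realType) (x : R) : R := ln x / ln 2.

Definition DCG (R : realType) (m n : nat) (s : 'S_m) (r : relevance m n) : R :=
  \sum_(i < m) (2 ^+ r i - 1) / log2 (1 + (((s^-1)%g i).+1)%:R).

(* The game is played with [m.+1] items, so that there is a top rank [ord0]. *)

Definition top_feedback (m n : nat) (s : 'S_m.+1) (r : relevance m.+1 n) :
  'I_n.+1 := r (s ord0).

(* A strategy draws a seed once and for all from an arbitrary probability
   space; the permutation played depends on the seed and on the list of past
   feedbacks, oldest first, whose length is the index of the round.  The past
   permutations are functions of these data, so they are not extra inputs. *)
Record learner (R : realType) (m n : nat) := Learner {
  seed_display : measure_display;
  seed : measurableType seed_display;
  seed_law : probability seed R;
  play : seq 'I_n.+1 -> seed -> 'S_m.+1;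
  measurable_play : forall (h : seq 'I_n.+1) (s : 'S_m.+1),
    measurable [set w | play h w = s] }.

Section game.
Variables (R : realType) (m n : nat).
Implicit Types (L : learner R m n) (r : nat -> relevance m.+1 n) (T : nat).

Fixpoint feedbacks L (w : seed L) r (t : nat) : seq 'I_n.+1 :=
  if t is t'.+1 then
    let h := feedbacks w r t' in rcons h (top_feedback (play h w) (r t'))
  else [::].

Definition total_gain L r T (w : seed L) : R :=
  \sum_(t < T) DCG R (play (feedbacks w r t) w) (r t).

(* The default value 0 of the maximum is harmless: DCG is nonnegative. *)
Definition best_fixed_gain r T : R :=
  \big[Num.max/0]_(s : 'S_m.+1) \sum_(t < T) DCG R s (r t).

(* The expectation is finite: [total_gain] takes finitely many values. *)
Definition expected_regret L r T : R :=
  best_fixed_gain r T - fine ('E_(seed_law L)[total_gain r T])%E.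

(* Only the first [T] vectors of the sequence [r] matter, so the supremum is
   over finitely many values and is a maximum. *)
Definition worst_case_regret L T : R :=
  sup [set expected_regret L r T | r in [set: nat -> relevance m.+1 n]].

Definition minimax_regret T : R :=
  inf [set x : R | exists L : learner R m n, x = worst_case_regret L T].

End game.

(* Main.v *)
(* Upper bound: with probability T^(-1/3) a uniformly random item is put on top,
   and its feedback, suitably rescaled, gives an unbiased estimate of the gains
   of all permutations.  Otherwise the learner plays regret matching: a
   permutation is drawn with probability proportional to the positive part of
   its estimated regret.  In expectation the sum of the squared positive parts
   grows by O(T^(1/3)) per round, so it is O(T^(4/3)) after T rounds, and every
   regret is O(T^(2/3)).

   Lower bound: item 0 is always relevant, and a coin of bias +eps or -eps, with
   eps of order T^(-1/3), decides which one of items 1 and 2 is relevant.  The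
   coin can be observed only by not putting item 0 on top, at a constant cost;
   otherwise, the cost of a wrong order of items 1 and 2 is of order eps.  Let u
   and v be the unnormalized posterior weights of the two biases.  The potential
   u v / (u + v) bounds the weight of either bias from below, and an observation
   multiplies its expectation by at least 1 - 4 eps^2.  Backward
   induction then gives a Bayesian regret of order T eps. *)
From HB Require Import structures.
Require Import Defs.
From mathcomp Require Import all_boot all_order all_algebra all_fingroup.
From mathcomp Require Import all_classical all_reals all_analysis.
From mathcomp Require Import ring lra.

Set Implicit Arguments.
Unset Strict Implicit.
Unset Printing Implicit Defensive.

Import Order.TTheory GRing.Theory Num.Theory.
Import numFieldNormedType.Exports.

Local Open Scope classical_set_scope.
Local Open Scope ring_scope.

(** * Discounts and gains *)

Section discount.
Variable R : realType.

Definition discount (k : nat) : R := (log2 (1 + k.+1%:R))^-1.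

Lemma log2_gt0 (k : nat) : 0 < log2 (1 + k.+1%:R : R).
Proof.
rewrite /log2 divr_gt0 ?ln_gt0 ?ltr1n//.
by rewrite ltrDl ltr0n.
Qed.

Lemma discount_gt0 k : 0 < discount k.
Proof. by rewrite invr_gt0 log2_gt0. Qed.

Lemma discount_lt j k : (j < k)%N -> discount k < discount j.
Proof.
move=> jk; rewrite ltf_pV2 ?posrE ?log2_gt0// /log2.
rewrite ltr_pM2r ?invr_gt0 ?ln_gt0 ?ltr1n// ltr_ln ?posrE ?addr_gt0 ?ltr0n//.
by rewrite ltrD2l ltr_nat.
Qed.

Lemma discount_le j k : (j <= k)%N -> discount k <= discount j.
Proof. by rewrite leq_eqVlt => /predU1P[->//|/discount_lt/ltW]. Qed.

Lemma discount0 : discount 0 = 1.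
Proof. by rewrite /discount /log2 -natr1 add0r -[1 + 1]/(2%:R) divff ?invr1// gt_eqF// ln_gt0 ?ltr1n. Qed.

Lemma discount_le1 k : discount k <= 1.
Proof. by rewrite -discount0 discount_le. Qed.

End discount.

Section gain.
Variables (R : realType) (m n : nat).
Implicit Types (f : seq 'I_n.+1 -> 'S_m.+1) (r : nat -> relevance m.+1 n).

Lemma DCGE (s : 'S_m.+1) (rho : relevance m.+1 n) :
  DCG R s rho = \sum_i (2 ^+ rho i - 1) * discount R ((s^-1)%g i).
Proof. by []. Qed.

Lemma grade_ge0 (a : 'I_n.+1) : 0 <= 2 ^+ a - 1 :> R.
Proof. by rewrite subr_ge0 exprn_ege1// ler1n. Qed.

Lemma grade_le (a : 'I_n.+1) : 2 ^+ a - 1 <= 2 ^+ n :> R.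
Proof.
rewrite lerBlDr ler_wpDr// ler_eXn2l ?ltr1n//.
by rewrite -ltnS ltn_ord.
Qed.

Lemma DCG_ge0 (s : 'S_m.+1) (rho : relevance m.+1 n) : 0 <= DCG R s rho.
Proof.
by rewrite DCGE sumr_ge0// => i _; rewrite mulr_ge0 ?grade_ge0// ltW// discount_gt0.
Qed.

Lemma DCG_le (s : 'S_m.+1) (rho : relevance m.+1 n) :
  DCG R s rho <= m.+1%:R * 2 ^+ n.
Proof.
rewrite DCGE -[m.+1 in leRHS]card_ord mulr_natl -sumr_const ler_sum// => i _.
rewrite -[leRHS]mulr1 ler_pM ?grade_ge0 ?grade_le ?discount_le1//.
exact/ltW/discount_gt0.
Qed.

(** Gain of a deterministic strategy unrolled from the first round: its feedback becomes the head of
    every later history. This form suits induction on the number of remaining rounds. *)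
Fixpoint gain k f r : R :=
  if k is k'.+1 then
    DCG R (f [::]) (r 0%N) +
    gain k' (fun h => f (top_feedback (f [::]) (r 0%N) :: h)) (fun t => r t.+1)
  else 0.

Fixpoint observed f r t : seq 'I_n.+1 :=
  if t is t'.+1 then
    rcons (observed f r t') (top_feedback (f (observed f r t')) (r t'))
  else [::].

Lemma feedbacksE (L : learner R m n) (w : seed L) r t :
  feedbacks w r t = observed (fun h => play h w) r t.
Proof. by elim: t => //= t ->. Qed.

Lemma observed_cons f r t :
  observed f r t.+1 = top_feedback (f [::]) (r 0%N) ::
    observed (fun h => f (top_feedback (f [::]) (r 0%N) :: h))
             (fun t => r t.+1) t.
Proof. by elim: t => // t IHt; rewrite [LHS]/= -/(observed f r t.+1) IHt. Qed.

Lemma gainE f r T :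
  gain T f r = \sum_(t < T) DCG R (f (observed f r t)) (r t).
Proof.
elim: T f r => [|T IHT] f r; first by rewrite big_ord0.
rewrite big_ord_recl [LHS]/= IHT; congr (_ + _).
by apply: eq_bigr => t _; rewrite lift0 observed_cons.
Qed.

Lemma total_gainE (L : learner R m n) (w : seed L) r T :
  total_gain r T w = gain T (fun h => play h w) r.
Proof. by rewrite gainE; apply: eq_bigr => t _; rewrite feedbacksE. Qed.

Lemma gain_ge0 k f r : 0 <= gain k f r.
Proof. by elim: k f r => //= k IHk f r; rewrite addr_ge0 ?DCG_ge0. Qed.

End gain.

(** * Learners with finitely many seeds *)

Section finite_seed.
Variables (R : realType) (m n : nat) (W : finType) (w0 : W) (p : W -> R).
Hypotheses (p_ge0 : forall w, 0 <= p w) (p_sum : \sum_w p w = 1).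

Let decode (i : nat) : W := nth w0 (enum W) i.

(** Seeds are coded by indices in [nat], where every set is measurable, so any finite family of
    strategies gives a learner. *)
Definition finite_law_fun : set nat -> \bar R :=
  msum (fun i => mscale (NngNum (p_ge0 (decode i))) (dirac i)) #|W|.

HB.instance Definition _ := Measure.on finite_law_fun.

Lemma finite_sum_decode (g : W -> R) : \sum_(i < #|W|) g (decode i) = \sum_w g w.
Proof. by rewrite -[RHS]big_enum (big_nth w0) -cardE big_mkord. Qed.

Lemma finite_law_setT : finite_law_fun [set: nat] = 1%E.
Proof.
rewrite /finite_law_fun /msum -p_sum -finite_sum_decode -sumEFin.
apply: eq_bigr => i _; transitivity ((p (decode i))%:E * \d_(i : nat) setT)%E => //.
by rewrite diracE in_setT mule1.
Qed.

HB.instance Definition _ :=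
  Measure_isProbability.Build _ _ _ finite_law_fun finite_law_setT.

Lemma finite_law_expectation (X : nat -> R) : (forall i, 0 <= X i) ->
  fine ('E_finite_law_fun[X])%E = \sum_(i < #|W|) p (decode i) * X i.
Proof.
move=> X0; rewrite unlock ge0_integral_measure_sum//.
- rewrite (eq_bigr (fun i : 'I__ => (p (decode i) * X i)%:E)) ?sumEFin// => i _.
  rewrite ge0_integral_mscale//; last by move=> x _; rewrite lee_fin.
  by rewrite integral_dirac//= diracE in_setT mul1e.
- by move=> i _; rewrite lee_fin.
Qed.

Definition finite_learner (f : W -> seq 'I_n.+1 -> 'S_m.+1) : learner R m n :=
  @Learner R m n _ _ (finite_law_fun : probability nat R)
    (fun h i => f (decode i) h) (fun h s => I).

Lemma finite_learner_gain f r T :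
  fine ('E_(seed_law (finite_learner f))[total_gain r T])%E
    = \sum_w p w * gain R T (f w) r.
Proof.
rewrite finite_law_expectation => [|i]; last by rewrite total_gainE gain_ge0.
rewrite -(finite_sum_decode (fun w => p w * gain R T (f w) r)).
by apply: eq_bigr => i _; rewrite total_gainE.
Qed.

End finite_seed.

(** Under a product law, a function of one coordinate sees only its marginal: [F] is absorbed into
    the factor [i0] and the other factors sum to 1. *)
Lemma prod_law_marginal (R : comNzRingType) (I J : finType) (p : I -> J -> R)
    (i0 : I) (F : J -> R) : (forall i, \sum_j p i j = 1) ->
  \sum_(g : {ffun I -> J}) (\prod_i p i (g i)) * F (g i0)
    = \sum_j p i0 j * F j.
Proof.
move=> p1; pose P i j := p i j * (if i == i0 then F j else 1).
transitivity (\sum_(g : {ffun I -> J}) \prod_i P i (g i)).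
  apply: eq_bigr => g _; rewrite big_split/=; congr (_ * _).
  by rewrite -big_mkcond big_pred1_eq.
rewrite -bigA_distr_bigA (bigD1 i0)//= [X in _ * X]big1 ?mulr1.
  by apply: eq_bigr => j _; rewrite /P eqxx.
move=> i /negPf ii0; rewrite -[RHS](p1 i).
by apply: eq_bigr => j _; rewrite /P ii0 mulr1.
Qed.

(** * Behavioural strategies as laws on decision trees *)

Section behavioural.
Variables (R : realType) (m n : nat) (S : Type) (A : finType).
Variables (act : A -> 'S_m.+1) (q : S -> A -> R) (upd : S -> A -> 'I_n.+1 -> S).
Hypotheses (q_ge0 : forall s a, 0 <= q s a) (q_sum : forall s, \sum_a q s a = 1).

Fixpoint plan (k : nat) : finType :=
  if k is k'.+1 then (A * {ffun 'I_n.+1 -> plan k'})%type else unit.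

(** The subtrees attached to the possible feedbacks are drawn independently, although a play visits
    only one of them. *)
Fixpoint plan_law k : S -> plan k -> R :=
  if k is k'.+1 return S -> plan k -> R then
    fun s w => q s w.1 * \prod_o plan_law (upd s w.1 o) (w.2 o)
  else fun _ _ => 1.

Fixpoint plan_play k : plan k -> seq 'I_n.+1 -> 'S_m.+1 :=
  if k is k'.+1 return plan k -> seq 'I_n.+1 -> 'S_m.+1 then
    fun w h => if h is o :: h' then plan_play (w.2 o) h' else act w.1
  else fun _ _ => 1%g.

Fixpoint value k (s : S) (r : nat -> relevance m.+1 n) : R :=
  if k is k'.+1 then
    \sum_a q s a * (DCG R (act a) (r 0%N) +
      value k' (upd s a (top_feedback (act a) (r 0%N))) (fun t => r t.+1))
  else 0.

Lemma plan_law_ge0 k s (w : plan k) : 0 <= plan_law s w.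
Proof.
by elim: k s w => //= k IHk s w; rewrite mulr_ge0// prodr_ge0.
Qed.

Lemma plan_law_sum k s : \sum_(w : plan k) plan_law s w = 1.
Proof.
elim: k s => [|k IHk] s /=; first by rewrite big_const card_unit/= addr0.
rewrite -(pair_bigA _ (fun a (g : {ffun 'I_n.+1 -> plan k}) => q s a * \prod_o plan_law (upd s a o) (g o)))/=.
rewrite -[RHS](q_sum s); apply: eq_bigr => a _.
rewrite -mulr_sumr -(bigA_distr_bigA (fun o w => plan_law (upd s a o) w)).
by rewrite big1 ?mulr1// => o _; rewrite IHk.
Qed.

Lemma plan_gain k s r :
  \sum_(w : plan k) plan_law s w * gain R k (plan_play w) r = value k s r.
Proof.
elim: k s r => [|k IHk] s r /=; first by rewrite big1// => w _; rewrite mulr0.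
set o0 := fun a => top_feedback (act a) (r 0%N).
rewrite -(pair_bigA _ (fun a (g : {ffun 'I_n.+1 -> plan k}) => q s a * (\prod_o plan_law (upd s a o) (g o)) *
  (DCG R (act a) (r 0%N) + gain R k (plan_play (g (o0 a))) (fun t => r t.+1))))/=.
apply: eq_bigr => a _; under eq_bigr do rewrite -mulrA.
rewrite -mulr_sumr; congr (_ * _).
rewrite (prod_law_marginal (p := fun o w => plan_law (upd s a o) w) (o0 a)
  (fun w => DCG R (act a) (r 0%N) + gain R k (plan_play w) (fun t => r t.+1))).
  under eq_bigr do rewrite mulrDr.
  by rewrite big_split/= -mulr_suml plan_law_sum mul1r IHk.
by move=> o; rewrite plan_law_sum.
Qed.

(* Kuhn's theorem: behavioural randomization is realized by drawing in advance
   an action for every feedback history. *)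
Lemma behavioural_learner k s : exists L : learner R m n, forall r,
  fine ('E_(seed_law L)[total_gain r k])%E = value k s r.
Proof.
(* Coding the seeds requires a default plan; one exists because the weights sum to 1. *)
case: (pickP (fun _ : plan k => true)) => [w0 _|W0].
  exists (finite_learner w0 (@plan_law_ge0 k s) (plan_law_sum k s)
            (fun w => plan_play w)) => r.
  by rewrite finite_learner_gain plan_gain.
have := plan_law_sum k s; rewrite big1 => [/eqP|w _]; last by have := W0 w.
by rewrite eq_sym oner_eq0.
Qed.

End behavioural.

(** * Regret matching with exploration *)

Section regret_matching.
Variables (R : realType) (m n : nat) (gamma lambda : R).
Hypotheses (gamma_gt0 : 0 < gamma) (gamma_le1 : gamma <= 1).
Hypothesis lambda_gt0 : 0 < lambda.

(** [U s] is the estimated cumulative regret for not having always played [s]. *)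
Let state := 'S_m.+1 -> R.
Implicit Types (U : state) (s : 'S_m.+1) (i : 'I_m.+1) (o : 'I_n.+1).

Definition pos_part (x : R) : R := Num.max 0 x.

Definition mass U : R := \sum_s pos_part (U s).

Definition match_law U s : R :=
  if mass U == 0 then (s == 1%g)%:R else pos_part (U s) / mass U.

(** Squared Euclidean distance from [U] to the nonpositive orthant, as in Blackwell
    approachability. *)
Definition potential U : R := \sum_s pos_part (U s) ^+ 2.

(* With probability [gamma] a uniformly random item is put on top; its feedback,
   divided by the probability of this event, estimates the gains without bias. *)
Definition rm_law U (a : 'S_m.+1 + 'I_m.+1) : R :=
  match a with
  | inl s => (1 - gamma) * match_law U s
  | inr _ => gamma / m.+1%:R
  end.

Definition rm_act (a : 'S_m.+1 + 'I_m.+1) : 'S_m.+1 :=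
  match a with inl s => s | inr i => tperm ord0 i end.

Definition estimate i o s : R :=
  m.+1%:R / gamma * ((2 ^+ o - 1) * discount R ((s^-1)%g i)).

Definition mean_estimate U i o : R := \sum_s match_law U s * estimate i o s.

Definition rm_update U (a : 'S_m.+1 + 'I_m.+1) o : state :=
  match a with
  | inl _ => U
  | inr i => fun s => U s + (estimate i o s - mean_estimate U i o)
  end.

Lemma pos_part_ge0 x : 0 <= pos_part x.
Proof. by rewrite le_max lexx. Qed.

Lemma pos_part_sqrD x y :
  pos_part (x + y) ^+ 2 <= pos_part x ^+ 2 + 2 * (pos_part x * y) + y ^+ 2.
Proof.
have -> : pos_part x ^+ 2 + 2 * (pos_part x * y) + y ^+ 2 = (pos_part x + y) ^+ 2.
  by ring.
have px : x <= pos_part x by rewrite le_max lexx orbT.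
rewrite {1}/pos_part; case: (lerP 0 (x + y)) => xy0.
  by rewrite ler_pXn2r ?nnegrE ?lerD2r// (le_trans xy0)// lerD2r.
by rewrite expr0n sqr_ge0.
Qed.

Lemma mass_ge0 U : 0 <= mass U.
Proof. by rewrite sumr_ge0// => s _; exact: pos_part_ge0. Qed.

Lemma match_law_ge0 U s : 0 <= match_law U s.
Proof.
by rewrite /match_law; case: ifP; rewrite ?ler0n// divr_ge0 ?pos_part_ge0 ?mass_ge0.
Qed.

Lemma match_law_sum U : \sum_s match_law U s = 1.
Proof.
rewrite /match_law; case: eqP => [_|/eqP U0]; last by rewrite -mulr_suml divff.
by rewrite (bigD1 1%g)//= eqxx big1 ?addr0// => s /negPf ->.
Qed.

(** This also covers zero mass, where all positive parts vanish; the fallback law of [match_law] is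
    then harmless. *)
Lemma pos_partE U s : pos_part (U s) = mass U * match_law U s.
Proof.
rewrite /match_law; case: eqP => [U0|/eqP U0]; last by rewrite mulrC divfK.
rewrite U0 mul0r; move/psumr_eq0P : U0; apply => // s' _; exact: pos_part_ge0.
Qed.

Lemma rm_law_ge0 U a : 0 <= rm_law U a.
Proof.
case: a => [s|i] /=; first by rewrite mulr_ge0 ?match_law_ge0// subr_ge0.
by rewrite divr_ge0// ltW.
Qed.

Lemma rm_law_sum U : \sum_a rm_law U a = 1.
Proof.
rewrite big_sumType/= -mulr_sumr match_law_sum mulr1 sumr_const card_ord.
by rewrite -[_ *+ _]mulr_natr divfK ?pnatr_eq0// subrK.
Qed.

Lemma estimate_ge0 i o s : 0 <= estimate i o s.
Proof.
rewrite /estimate mulr_ge0//; first by rewrite divr_ge0// ltW.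
by rewrite mulr_ge0 ?grade_ge0// ltW// discount_gt0.
Qed.

Lemma estimate_le i o s : estimate i o s <= m.+1%:R * 2 ^+ n / gamma.
Proof.
rewrite /estimate mulrAC ler_pM2r ?invr_gt0// ler_pM2l ?ltr0n//.
rewrite -[leRHS]mulr1 ler_pM ?grade_ge0 ?grade_le ?discount_le1//.
exact/ltW/discount_gt0.
Qed.

Lemma mean_estimate_ge0 U i o : 0 <= mean_estimate U i o.
Proof. by rewrite sumr_ge0// => s _; rewrite mulr_ge0 ?match_law_ge0 ?estimate_ge0. Qed.

Lemma mean_estimate_le U i o : mean_estimate U i o <= m.+1%:R * 2 ^+ n / gamma.
Proof.
rewrite -[leRHS]mul1r -[X in _ <= X * _](match_law_sum U) mulr_suml ler_sum// => s _.
by rewrite ler_wpM2l ?match_law_ge0 ?estimate_le.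
Qed.

Lemma estimate_unbiased s (rho : relevance m.+1 n) :
  \sum_i gamma / m.+1%:R * estimate i (rho i) s = DCG R s rho.
Proof.
rewrite DCGE; apply: eq_bigr => i _; rewrite /estimate -(invf_div m.+1%:R).
by rewrite mulKf// mulf_neq0 ?invr_eq0 ?pnatr_eq0 ?gt_eqF.
Qed.

(** Blackwell's condition: the increment is centred under [match_law], which is proportional to the
    positive parts, so the first-order term vanishes. Only the squares of the increments remain. *)
Lemma potential_update U i o :
  potential (rm_update U (inr i) o) <=
    potential U + #|'S_m.+1|%:R * (m.+1%:R * 2 ^+ n / gamma) ^+ 2.
Proof.
set B := _ / gamma; pose d s := estimate i o s - mean_estimate U i o.
have cross : \sum_s 2 * (pos_part (U s) * d s) = 0.
  rewrite -mulr_sumr; under eq_bigr do rewrite pos_partE -mulrA.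
  rewrite -mulr_sumr; under eq_bigr do rewrite mulrBr.
  by rewrite sumrB -mulr_suml match_law_sum mul1r subrr !mulr0.
apply: (@le_trans _ _ (\sum_s (pos_part (U s) ^+ 2 + 2 * (pos_part (U s) * d s)
                               + d s ^+ 2))).
  by apply: ler_sum => s _; exact: pos_part_sqrD.
rewrite big_split/= big_split/= cross addr0 lerD2l.
rewrite mulr_natl -sumr_const ler_sum// => s _.
rewrite -[leLHS]real_normK ?num_real// ler_pXn2r ?nnegrE ?normr_ge0//.
  have := conj (estimate_ge0 i o s) (estimate_le i o s).
  have := conj (mean_estimate_ge0 U i o) (mean_estimate_le U i o).
  rewrite /d -/B ler_norml => -[mu0 muB] [e0 eB].
  by apply/andP; split; lra.
by rewrite (le_trans _ (estimate_le i o 1%g)) ?estimate_ge0.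
Qed.

Definition rm_value := @value R m n _ _ rm_act rm_law rm_update.

(** The gain forgone by exploring, plus the mean growth of the potential divided by [2 * lambda]. *)
Definition round_cost : R :=
  gamma * (m.+1%:R * 2 ^+ n) +
  gamma * (#|'S_m.+1|%:R * (m.+1%:R * 2 ^+ n / gamma) ^+ 2) / (2 * lambda).

(** The bound [y <= y ^+ 2 / (2 * lambda) + lambda / 2] replaces a square root of the potential by a
    linear term, so that the induction commutes with averaging over the action. *)
Lemma rm_value_ge k U (r : nat -> relevance m.+1 n) s :
  \sum_(t < k) DCG R s (r t) + U s - potential U / (2 * lambda) - lambda / 2
    - k%:R * round_cost <= rm_value k U r.
Proof.
elim: k U r => [|k IHk] U r.
  rewrite /rm_value/= big_ord0 mul0r subr0 add0r.
  have h1 : U s <= pos_part (U s) by rewrite le_max lexx orbT.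
  have h2 : pos_part (U s) ^+ 2 <= potential U.
    by rewrite /potential (bigD1 s)//= lerDl sumr_ge0// => *; rewrite sqr_ge0.
  have h3 : U s <= pos_part (U s) ^+ 2 / (2 * lambda) + lambda / 2.
    rewrite (le_trans h1)// -subr_ge0.
    set y := pos_part _.
    have -> : y ^+ 2 / (2 * lambda) + lambda / 2 - y = (y - lambda) ^+ 2 / (2 * lambda).
      by field; rewrite gt_eqF.
    by rewrite divr_ge0 ?sqr_ge0// mulr_ge0// ltW.
  have h4 : pos_part (U s) ^+ 2 / (2 * lambda) <= potential U / (2 * lambda).
    by rewrite ler_pM2r// invr_gt0 mulr_gt0.
  lra.
rewrite big_ord_recl (eq_bigr (fun t : 'I_k => DCG R s (r t.+1))); last first.
  by move=> t _; rewrite lift0.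
set rho := r 0%N; pose r' t := r t.+1.
pose fut := \sum_(t < k) DCG R s (r' t).
(* [X V] is the bound given by the induction hypothesis when the remaining rounds start from the
   state [V]. *)
pose X V := fut + V s - potential V / (2 * lambda) - lambda / 2 - k%:R * round_cost.
have IH V : X V <= rm_value k V r' := IHk V r'.
pose NB := #|'S_m.+1|%:R * (m.+1%:R * 2 ^+ n / gamma) ^+ 2.
pose G := \sum_s match_law U s * DCG R s rho.
have GD : G <= m.+1%:R * 2 ^+ n.
  rewrite -[leRHS]mul1r -[X in _ <= X * _](match_law_sum U) mulr_suml ler_sum// => s' _.
  by rewrite ler_wpM2l ?match_law_ge0 ?DCG_le.
have Gmean : \sum_i gamma / m.+1%:R * mean_estimate U i (rho i) = G.
  under eq_bigr do rewrite mulr_sumr.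
  rewrite exchange_big/=; apply: eq_bigr => s' _.
  by rewrite -estimate_unbiased mulr_sumr; apply: eq_bigr => i _; rewrite mulrCA.
have XU i : X U + (estimate i (rho i) s - mean_estimate U i (rho i))
    - NB / (2 * lambda) <= X (rm_update U (inr i) (rho i)).
  have h : potential (rm_update U (inr i) (rho i)) / (2 * lambda) <=
      potential U / (2 * lambda) + NB / (2 * lambda).
    by rewrite -mulrDl ler_pM2r ?invr_gt0 ?mulr_gt0// potential_update.
  by rewrite /X/=; lra.
rewrite /rm_value/= big_sumType/= -/(rm_value) -/rho -/r'.
have e1 : (1 - gamma) * G + (1 - gamma) * X U <= \sum_s' (1 - gamma) * match_law U s' *
    (DCG R s' rho + rm_value k U r').
  rewrite -mulrDr; under [leRHS]eq_bigr do rewrite -mulrA.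
  rewrite -mulr_sumr ler_wpM2l ?subr_ge0//.
  under [leRHS]eq_bigr do rewrite mulrDr.
  by rewrite big_split/= lerD2l -mulr_suml match_law_sum mul1r.
(* Exploration: the gain of the round is dropped, being nonnegative. By unbiasedness, the estimated
   regret of [s] moves on average by its true increment [DCG R s rho - G]. *)
have e2 : gamma * X U + DCG R s rho - G - gamma * NB / (2 * lambda) <=
    \sum_i gamma / m.+1%:R * (DCG R (tperm ord0 i) rho + rm_value k
      (rm_update U (inr i) (top_feedback (tperm ord0 i) rho)) r').
  rewrite -estimate_unbiased -Gmean.
  have -> : gamma * X U + \sum_i gamma / m.+1%:R * estimate i (rho i) s -
       \sum_i gamma / m.+1%:R * mean_estimate U i (rho i) - gamma * NB / (2 * lambda)
     = \sum_i gamma / m.+1%:R * (X U + (estimate i (rho i) s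
          - mean_estimate U i (rho i)) - NB / (2 * lambda)).
    rewrite [RHS](eq_bigr (fun i => (gamma / m.+1%:R * estimate i (rho i) s -
      gamma / m.+1%:R * mean_estimate U i (rho i)) +
      gamma / m.+1%:R * (X U - NB / (2 * lambda)))); last by move=> i _; ring.
    rewrite big_split/= sumrB sumr_const card_ord -[X in _ = _ + X]mulr_natr [X in _ = _ + X]mulrAC.
    by rewrite divfK ?pnatr_eq0//; ring.
  apply: ler_sum => i _; apply: ler_wpM2l; first by rewrite divr_ge0// ltW.
  rewrite /top_feedback tpermL (le_trans (XU i))// (le_trans (IH _))//.
  by rewrite lerDr DCG_ge0.
(* The estimates charge [G], but exploitation earns only [(1 - gamma) * G]; this bounds the
   difference. *)
have e3 : gamma * G <= gamma * (m.+1%:R * 2 ^+ n) by rewrite ler_wpM2l// ltW.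
apply: le_trans (lerD e1 e2).
have -> : DCG R s rho + \sum_(t < k) DCG R s (r t.+1) + U s -
    potential U / (2 * lambda) - lambda / 2 - k.+1%:R * round_cost
    = DCG R s rho + X U - round_cost.
  by rewrite /X /fut -[k.+1%:R]natr1 /r'; ring.
rewrite /round_cost -/NB.
lra.
Qed.

End regret_matching.

Lemma discrete_preimage_measurable d (T : measurableType d) (C : countType)
    (X : T -> C) : (forall c, measurable [set w | X w = c]) ->
  forall P : set C, measurable [set w | P (X w)].
Proof.
move=> mX P.
have -> : [set w | P (X w)] = \bigcup_c ([set w | X w = c] `&` [set w | P c]).
  by apply/seteqP; split => w /=; [exists (X w)|case=> c _ [/= ->]].
apply: countable_bigcupT_measurable => [|c]; first exact: countableP.
apply: measurableI => //; have [Pc|Pc] := pselect (P c).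
  by rewrite (_ : mkset _ = setT)//; apply/seteqP; split.
by rewrite (_ : mkset _ = set0)//; apply/seteqP; split.
Qed.

(** * Expectations and averages over coin tosses *)

Section expected_gain.
Variables (R : realType) (m n : nat) (L : learner R m n).
Implicit Types (r : nat -> relevance m.+1 n).

(** A learner is measurable for each fixed history; since histories are countable, the event splits
    over the values of the pair of past history and permutation. *)
Lemma measurable_feedbacks r t h : measurable [set w : seed L | feedbacks w r t = h].
Proof.
elim: t h => [|t IHt] h /=.
  have [<-|h0] := pselect ([::] = h).
    by rewrite (_ : mkset _ = setT)//; apply/seteqP; split.
  by rewrite (_ : mkset _ = set0)//; apply/seteqP; split.
pose X (w : seed L) := (feedbacks w r t, play (feedbacks w r t) w).
apply: (@discrete_preimage_measurable _ _ _ X _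
  (fun c => rcons c.1 (top_feedback c.2 (r t)) = h)) => -[h' s].
rewrite (_ : mkset _ = [set w | feedbacks w r t = h'] `&` [set w | play h' w = s]).
  by apply: measurableI => //; exact: measurable_play.
by apply/seteqP; split => w /=; [case=> -> ->|case=> + <- => <-].
Qed.

Lemma measurable_play_feedbacks r t s :
  measurable [set w : seed L | play (feedbacks w r t) w = s].
Proof.
pose X (w : seed L) := (feedbacks w r t, play (feedbacks w r t) w).
apply: (@discrete_preimage_measurable _ _ _ X _ (fun c => c.2 = s)) => -[h' s'].
rewrite (_ : mkset _ = [set w | feedbacks w r t = h'] `&` [set w | play h' w = s']).
  apply: measurableI; first exact: measurable_feedbacks.
  exact: measurable_play.
by apply/seteqP; split => w /=; [case=> -> ->|case=> + <- => <-].
Qed.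

Lemma total_gain_ge0 r T (w : seed L) : 0 <= total_gain r T w.
Proof. by rewrite total_gainE gain_ge0. Qed.

Lemma total_gain_Lfun r T : (total_gain r T : seed L -> R) \in Lfun (seed_law L) 1.
Proof.
apply/Lfun1_integrable; apply: measurable_bounded_integrable => //.
- by apply: le_lt_trans (probability_le1 (seed_law L) _) _; rewrite ?ltry.
- rewrite /total_gain; apply: measurable_sum => t _ Y mY; rewrite setTI.
  exact: (discrete_preimage_measurable (measurable_play_feedbacks r t)
            (fun s => Y (DCG R s (r t)))).
- exists (T%:R * (m.+1%:R * 2 ^+ n)); split; first exact: num_real.
  move=> M /ltW ltM w _ /=; rewrite ger0_norm ?total_gain_ge0// (le_trans _ ltM)//.
  rewrite mulr_natl -[T in leRHS]card_ord -sumr_const ler_sum// => t _.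
  exact: DCG_le.
Qed.

Definition expected_gain r T : R := fine ('E_(seed_law L)[total_gain r T])%E.

Lemma expected_gain_ge0 r T : 0 <= expected_gain r T.
Proof. by rewrite fine_ge0// expectation_ge0// => w; exact: total_gain_ge0. Qed.

Lemma best_fixed_gain_le r T x : 0 <= x ->
  (forall s, \sum_(t < T) DCG R s (r t) <= x) -> best_fixed_gain R r T <= x.
Proof. by move=> x0 sx; apply/bigmax_leP; split. Qed.

Lemma best_fixed_gain_ge r T s :
  \sum_(t < T) DCG R s (r t) <= best_fixed_gain R r T.
Proof. exact: (le_bigmax _ (fun s => \sum_(t < T) DCG R s (r t))). Qed.

(** The supremum is a true upper bound because regrets are bounded by the largest possible total
    gain. *)
Lemma worst_case_regret_ge r T : expected_regret L r T <= worst_case_regret L T.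
Proof.
apply: ub_le_sup; last by exists r.
exists (T%:R * (m.+1%:R * 2 ^+ n)) => _ [r' _ <-].
rewrite lerBlDr.
apply: (@le_trans _ _ (T%:R * (m.+1%:R * 2 ^+ n))); last first.
  by rewrite lerDl expected_gain_ge0.
rewrite best_fixed_gain_le ?mulr_ge0 ?exprn_ge0// => s.
rewrite mulr_natl -[T in leRHS]card_ord -sumr_const ler_sum// => t _.
exact: DCG_le.
Qed.

End expected_gain.

Section coin_average.
Variables (R : realType) (m n : nat) (rel : bool -> relevance m.+1 n).
Implicit Types (p : R) (Phi Psi : (nat -> relevance m.+1 n) -> R).

Definition cons_seq (T : Type) (x : T) (r : nat -> T) (t : nat) : T :=
  if t is t'.+1 then r t' else x.

(** Mean over [k] independent tosses, as nested finite sums in place of a product measure. The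
    constant tail is not seen by gains over [k] rounds. *)
Fixpoint avg p (k : nat) Phi : R :=
  if k is k'.+1 then
    p * avg p k' (fun r => Phi (cons_seq (rel true) r)) +
    (1 - p) * avg p k' (fun r => Phi (cons_seq (rel false) r))
  else Phi (fun=> rel true).

Lemma avg_addc p k (c : R) Phi :
  avg p k (fun r => c + Phi r) = c + avg p k Phi.
Proof. by elim: k Phi => //= k IHk Phi; rewrite !IHk; ring. Qed.

Lemma avgB p k Phi Psi :
  avg p k (fun r => Phi r - Psi r) = avg p k Phi - avg p k Psi.
Proof. by elim: k Phi Psi => //= k IHk Phi Psi; rewrite !IHk; ring. Qed.

Lemma avg_le p k Phi Psi : 0 <= p <= 1 -> (forall r, Phi r <= Psi r) ->
  avg p k Phi <= avg p k Psi.
Proof.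
move=> /andP[p0 p1]; elim: k Phi Psi => //= k IHk Phi Psi PhiPsi.
by rewrite lerD// ler_wpM2l ?subr_ge0// IHk.
Qed.

Lemma avg_le_cst p k Phi (c : R) : 0 <= p <= 1 -> (forall r, Phi r <= c) ->
  avg p k Phi <= c.
Proof.
move=> p01 Phic; apply: le_trans (avg_le k p01 Phic) _.
by elim: k => //= k IHk; have [p0 p1] := andP p01; nra.
Qed.

(** Fubini for finitely many tosses, by linearity of expectation. The map [c] prepends the tosses
    already fixed, which makes the induction go through. *)
Lemma avg_expected_gain (L : learner R m n) T p k
    (c : (nat -> relevance m.+1 n) -> nat -> relevance m.+1 n) :
  let X (w : seed L) := avg p k (fun r => total_gain (c r) T w) in
  X \in Lfun (seed_law L) 1 /\
  ('E_(seed_law L)[X] = (avg p k (fun r => expected_gain L (c r) T))%:E)%E.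
Proof.
elim: k c => [|k IHk] c /=.
  split; first exact: total_gain_Lfun.
  by rewrite /expected_gain fineK// expectation_fin_num// total_gain_Lfun.
have [X1 E1] := IHk (fun r => c (cons_seq (rel true) r)).
have [X2 E2] := IHk (fun r => c (cons_seq (rel false) r)).
set Y1 := (fun w => avg _ _ _) in X1 E1; set Y2 := (fun w => avg _ _ _) in X2 E2.
have -> : (fun w => p * avg p k (fun r => total_gain (c (cons_seq (rel true) r)) T w)
   + (1 - p) * avg p k (fun r => total_gain (c (cons_seq (rel false) r)) T w)) =
   (p \o* Y1) \+ ((1 - p) \o* Y2).
  by apply/funext => w /=; rewrite mulrC [X in _ + X]mulrC.
have Z1 : p \o* Y1 \in Lfun (seed_law L) 1.
  by rewrite (_ : p \o* Y1 = p *: Y1) ?rpredZ//; apply/funext => w; rewrite /= mulrC.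
have Z2 : (1 - p) \o* Y2 \in Lfun (seed_law L) 1.
  by rewrite (_ : _ \o* Y2 = (1 - p) *: Y2) ?rpredZ//; apply/funext => w; rewrite /= mulrC.
split; first by rewrite rpredD.
by rewrite expectationD// !expectationZl// E1 E2.
Qed.

Lemma avg_gainS p k (f : seq 'I_n.+1 -> 'S_m.+1) :
  avg p k.+1 (gain R k.+1 f) =
  p * (DCG R (f [::]) (rel true) +
       avg p k (gain R k (fun h => f (top_feedback (f [::]) (rel true) :: h)))) +
  (1 - p) * (DCG R (f [::]) (rel false) +
       avg p k (gain R k (fun h => f (top_feedback (f [::]) (rel false) :: h)))).
Proof. by rewrite -!avg_addc. Qed.

Lemma avg_gain_cst p k (s : 'S_m.+1) :
  avg p k (gain R k (fun=> s)) =
  k%:R * (p * DCG R s (rel true) + (1 - p) * DCG R s (rel false)).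
Proof.
by elim: k => [|k IHk]; rewrite ?mul0r// avg_gainS IHk -natr1; ring.
Qed.

End coin_average.

(** * The Bayesian lower bound *)

Section bayes.
Variables (R : realType) (m n : nat) (rel : bool -> relevance m.+1 n).
Variables (eps best c h : R).
Hypotheses (eps_gt0 : 0 < eps) (eps_lt : eps < 1 / 2) (h_ge0 : 0 <= h).

(** Half the harmonic mean, hence between half the minimum of [u] and [v] and that minimum when both
    are positive. *)
Definition hmean (u v : R) : R := u * v / (u + v).

Lemma hmean_le_quarter (u v : R) : 0 < u -> 0 < v ->
  hmean u v <= (u + v) / 4.
Proof.
move=> u0 v0; rewrite /hmean ler_pdivrMr ?addr_gt0//.
by have := sqr_ge0 (u - v); nra.
Qed.

Lemma hmean_lel (u v : R) : 0 < u -> 0 < v -> hmean u v <= u.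
Proof. by move=> u0 v0; rewrite /hmean ler_pdivrMr ?addr_gt0//; nra. Qed.

Lemma hmean_ler (u v : R) : 0 < u -> 0 < v -> hmean u v <= v.
Proof. by move=> u0 v0; rewrite /hmean ler_pdivrMr ?addr_gt0//; nra. Qed.

Lemma hmean_ge0 (u v : R) : 0 < u -> 0 < v -> 0 <= hmean u v.
Proof. by move=> u0 v0; rewrite /hmean divr_ge0 ?mulr_ge0 ?addr_ge0// ltW. Qed.

(* One observation of the coin keeps at least the fraction [1 - 4 eps^2] of the
   expected potential. *)
Lemma hmean_split (u v : R) : 0 < u -> 0 < v ->
  (1 - 4 * eps ^+ 2) * hmean u v <=
  hmean (u * (1 / 2 + eps)) (v * (1 / 2 - eps)) +
  hmean (u * (1 / 2 - eps)) (v * (1 / 2 + eps)).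
Proof.
move=> u0 v0; rewrite /hmean.
set p := 1 / 2 + eps; set q := 1 / 2 - eps.
have p0 : 0 < p by rewrite /p; move: eps_gt0; lra.
have q0 : 0 < q by rewrite /q; move: eps_lt; lra.
have s0 : 0 < u * p + v * q by rewrite addr_gt0 ?mulr_gt0.
have t0 : 0 < u * q + v * p by rewrite addr_gt0 ?mulr_gt0.
have uv0 : 0 < u + v by rewrite addr_gt0.
(* The two factors sum to [u + v], so this is the inequality between geometric and arithmetic
   means. *)
have st : (u * p + v * q) * (u * q + v * p) <= (u + v) ^+ 2 / 4.
  rewrite -subr_ge0 (_ : _ - _ = (eps * (u - v)) ^+ 2) ?sqr_ge0//.
  by rewrite /p /q; field.
have -> : 1 - 4 * eps ^+ 2 = 4 * p * q by rewrite /p /q; field.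
have -> : u * p * (v * q) / (u * p + v * q) + u * q * (v * p) / (u * q + v * p) =
  u * v * p * q * (u + v) / ((u * p + v * q) * (u * q + v * p)).
  have pq1 : p + q = 1 by rewrite /p /q; lra.
  rewrite -[u + v]mulr1 -pq1; field.
  by rewrite !gt_eqF.
rewrite ler_pdivlMr ?mulr_gt0//.
have -> : u * v * p * q * (u + v) =
  4 * p * q * (u * v / (u + v)) * ((u + v) ^+ 2 / 4) by field; rewrite gt_eqF.
rewrite ler_wpM2l// !mulr_ge0 ?invr_ge0// ltW//.
Qed.

Definition mean_loss (p : R) (s : 'S_m.+1) : R :=
  best - (p * DCG R s (rel true) + (1 - p) * DCG R s (rel false)).

Let explores (s : 'S_m.+1) := s ord0 != ord0.

Hypothesis rel_ord0 : rel true ord0 = rel false ord0.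
Hypothesis loss_explore : forall s, explores s ->
  c <= mean_loss (1 / 2 + eps) s /\ c <= mean_loss (1 / 2 - eps) s.
Hypothesis loss_exploit : forall s (u v : R), ~~ explores s -> 0 < u -> 0 < v ->
  h * hmean u v <=
    u * mean_loss (1 / 2 + eps) s + v * mean_loss (1 / 2 - eps) s.

(** Exploring costs at least [c * (u + v)], hence [4 * c * hmean u v], which pays for this round and
    for the potential lost over the remaining ones. The condition involves a fixed horizon [K] so
    that it persists through the induction. *)
Lemma bayes_regret (K k : nat) (f : seq 'I_n.+1 -> 'S_m.+1) (u v : R) :
  (k <= K)%N -> h * (1 + 4 * K%:R * eps ^+ 2) <= 4 * c -> 0 < u -> 0 < v ->
  k%:R * h * hmean u v <=
    u * (k%:R * best - avg rel (1 / 2 + eps) k (gain R k f)) +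
    v * (k%:R * best - avg rel (1 / 2 - eps) k (gain R k f)).
Proof.
move=> kK hK; elim: k f u v kK => [|k IHk] f u v kK u0 v0.
  by rewrite !mul0r !subr0 /= !mulr0 addr0.
rewrite !avg_gainS -[k.+1%:R]natr1.
set ft := (fun h => f (top_feedback _ (rel true) :: h)).
set ff := (fun h => f (top_feedback _ (rel false) :: h)).
set Ptt := avg _ _ _ (gain R k ft); set Ptf := avg _ _ _ (gain R k ff).
set Pft := avg _ (_ - _) _ (gain R k ft); set Pff := avg _ (_ - _) _ (gain R k ff).
have IH g x y := IHk g x y (ltnW kK).
have p0 : 0 < 1 / 2 + eps by move: eps_gt0; lra.
have q0 : 0 < 1 / 2 - eps by move: eps_lt; lra.
have [/[dup] ex /loss_explore[cp cq]|nex] := boolP (explores (f [::])).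
  (* Bayes' rule: each outcome multiplies the weights by its likelihoods. The toss is treated as
     revealed, whatever the top item shows. *)
  have It := IH ft (u * (1 / 2 + eps)) (v * (1 / 2 - eps)).
  have If := IH ff (u * (1 / 2 - eps)) (v * (1 / 2 + eps)).
  have := lerD (It (mulr_gt0 u0 p0) (mulr_gt0 v0 q0))
               (If (mulr_gt0 u0 q0) (mulr_gt0 v0 p0)).
  rewrite -/Ptt -/Ptf -/Pft -/Pff -mulrDr => ItIf.
  have kh0 : 0 <= k%:R * h by rewrite mulr_ge0.
  have := le_trans (ler_wpM2l kh0 (hmean_split u0 v0)) ItIf.
  move: cp cq; rewrite /mean_loss.
  set dt := DCG _ _ _; set df := DCG _ _ _ => cp cq main.
  have ucp := ler_wpM2l (ltW u0) cp; have vcq := ler_wpM2l (ltW v0) cq.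
  have kK' : (k%:R : R) <= K%:R by rewrite ler_nat ltnW.
  have hk : h * (1 + 4 * k%:R * eps ^+ 2) <= 4 * c.
    rewrite (le_trans _ hK)// ler_wpM2l// lerD2l ler_wpM2r ?sqr_ge0//.
    by rewrite ler_pM2l.
  have hm0 := hmean_ge0 u0 v0.
  have key : h * (1 + 4 * k%:R * eps ^+ 2) * hmean u v <= c * (u + v).
    apply: le_trans (ler_wpM2r hm0 hk) _.
    have c0 : 0 <= 4 * c.
      by apply: le_trans hk; rewrite mulr_ge0 ?addr_ge0 ?mulr_ge0 ?ler0n ?(ltW eps_gt0).
    apply: le_trans (ler_wpM2l c0 (hmean_le_quarter u0 v0)) _.
    lra.
  move: (hmean u v) main key => H main key.
  clearbody Ptt Ptf Pft Pff dt df.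
  clear -main key ucp vcq.
  lra.
(* With item 0 on top both tosses give the same feedback, so the continuation and the weights do not
   change. *)
have eqf : ft = ff.
  apply/funext => w; rewrite /ft /ff /top_feedback.
  by move/negPn/eqP: nex => ->; rewrite rel_ord0.
have := IH ft u v u0 v0; rewrite -/Ptt -/Pft => ih.
have := loss_exploit nex u0 v0; rewrite /mean_loss => le.
rewrite /Ptf /Pff -eqf -/Ptt -/Pft.
move: (hmean u v) ih le => H ih le.
clearbody Ptt Pft; clear -ih le.
by lra.
Qed.

End bayes.

(** * The hard instance *)

Section hard_instance.
Variables (R : realType) (m n : nat) (eps : R).
Hypotheses (m_ge2 : (2 <= m)%N) (n_ge1 : (1 <= n)%N).
Hypotheses (eps_ge0 : 0 <= eps) (eps_le : eps <= 1 / 4).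
Let d := discount R.

Definition item1 : 'I_m.+1 := inord 1.
Definition item2 : 'I_m.+1 := inord 2.

(* Item 0 is always relevant; the coin [b] decides between items 1 and 2. *)
Definition hard (b : bool) : relevance m.+1 n :=
  [ffun i => if (i == ord0) || (i == if b then item1 else item2)
             then inord 1 else ord0].

(** Mean gain of ranking item 0, then the likelier of items 1 and 2, then the other; by symmetry it
    is the same for both biases. *)
Definition hard_best : R := d 0 + (1 / 2 + eps) * d 1 + (1 / 2 - eps) * d 2.

Lemma item1E : item1 = 1%N :> nat.
Proof. by rewrite /item1 inordK// ltnS ltnW. Qed.

Lemma item2E : item2 = 2%N :> nat.
Proof. by rewrite /item2 inordK// ltnS. Qed.

Lemma DCG_hard (s : 'S_m.+1) b :
  DCG R s (hard b) =
  d ((s^-1)%g ord0) + d ((s^-1)%g (if b then item1 else item2)).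
Proof.
have i0 : (if b then item1 else item2) != ord0.
  by apply/eqP => /(congr1 val)/=; case: b; rewrite ?item1E ?item2E.
rewrite DCGE (bigD1 ord0)//= (bigD1 (if b then item1 else item2))//=.
rewrite big1 => [|i /andP[/negPf i1 /negPf i2]].
  rewrite addr0 !ffunE !eqxx orbT/= inordK ?ltnS//.
  by rewrite expr1 (_ : 2 - 1 = 1) ?mul1r//; ring.
by rewrite ffunE i1 i2 expr0 subrr mul0r.
Qed.

(** Capping ranks at 2 leaves finitely many cases to compare. *)
Lemma discount_cap k : d k <= d (minn k 2).
Proof. by rewrite discount_le// geq_minl. Qed.

Let d01 : d 1 < d 0. Proof. exact: discount_lt. Qed.
Let d12 : d 2 < d 1. Proof. exact: discount_lt. Qed.

(** The cheapest deviation swaps item 0 with the likelier item and costs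
    [(1 / 2 - eps) * (d 0 - d 1)]; the constant 1/4 then comes from [eps <= 1 / 4]. *)
Lemma hard_loss_explore (x y z : nat) p : (0 < x)%N ->
  x != y -> y != z -> x != z -> p = 1 / 2 + eps \/ p = 1 / 2 - eps ->
  (d 0 - d 1) / 4 <= hard_best - (p * (d x + d y) + (1 - p) * (d x + d z)).
Proof.
move=> x0 xy yz xz pE.
have [e0 e1] := (eps_ge0, eps_le).
have p0 : 0 <= p by case: pE => ->; lra.
have q0 : 0 <= 1 - p by case: pE => ->; lra.
have Dx := discount_cap x.
have Dy := ler_wpM2l p0 (discount_cap y).
have Dz := ler_wpM2l q0 (discount_cap z).
have := (d01, d12) => -[/ltW D01 /ltW D12].
have E1 : 0 <= eps * (d 0 - d 1) by rewrite mulr_ge0// subr_ge0.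
have E2 : 0 <= eps * (d 1 - d 2) by rewrite mulr_ge0// subr_ge0.
have E3 : 0 <= (1 / 4 - eps) * (d 0 - d 1) by rewrite mulr_ge0// subr_ge0.
have E4 : 0 <= (1 / 4 - eps) * (d 1 - d 2) by rewrite mulr_ge0// subr_ge0.
suff : (d 0 - d 1) / 4 <= hard_best -
    (d (minn x 2) + p * d (minn y 2) + (1 - p) * d (minn z 2)) by lra.
rewrite /hard_best; clear Dx Dy Dz p0 q0.
by case: x y z x0 xy yz xz => [|[|x]] [|[|y]] [|[|z]]//= _ _ _ _;
  rewrite ?/(minn _.+2 2)/= ?/(minn 0 2)/= ?/(minn 1 2)/=; case: pE => ->; lra.
Qed.

(** Any placement of items 1 and 2 loses at least [2 * (d 1 - d 2) * eps] under one of the biases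
    and is no better than [hard_best] under the other; [hmean u v] is below both weights. *)
Lemma hard_loss_exploit (y z : nat) (u v : R) :
  y != 0%N -> y != z -> z != 0%N -> 0 < u -> 0 < v ->
  2 * (d 1 - d 2) * eps * hmean u v <=
  u * (hard_best - ((1 / 2 + eps) * (d 0 + d y) + (1 - (1 / 2 + eps)) * (d 0 + d z))) +
  v * (hard_best - ((1 / 2 - eps) * (d 0 + d y) + (1 - (1 / 2 - eps)) * (d 0 + d z))).
Proof.
move=> y0 yz z0 u0 v0.
have [e0 e1] := (eps_ge0, eps_le).
have := (d01, d12) => -[/ltW D01 /ltW D12].
have E1 : 0 <= eps * (d 1 - d 2) by rewrite mulr_ge0// subr_ge0.
have E2 : 0 <= (1 / 4 - eps) * (d 1 - d 2) by rewrite mulr_ge0// subr_ge0.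
set h := 2 * (d 1 - d 2) * eps.
have h0 : 0 <= h by rewrite /h; lra.
have p0 : 0 <= 1 / 2 + eps by lra.
have q0 : 0 <= 1 / 2 - eps by lra.
have py := ler_wpM2l p0 (discount_cap y).
have pz := ler_wpM2l p0 (discount_cap z).
have qy := ler_wpM2l q0 (discount_cap y).
have qz := ler_wpM2l q0 (discount_cap z).
set lp := hard_best - _; set lm := hard_best - _.
have lpm : (h <= lp /\ 0 <= lm) \/ (0 <= lp /\ h <= lm).
  rewrite /lp /lm /h /hard_best; clear h h0 lp lm.
  case: y z y0 yz z0 py pz qy qz => [|[|y]] [|[|z]]//= _ _ _;
  rewrite ?/(minn _.+2 2)/= ?/(minn 1 2)/= => py pz qy qz;
  (try by right; split; lra); by left; split; lra.
have [lp0 lm0] : 0 <= lp /\ 0 <= lm by case: lpm => -[]; split; lra.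
have hu := ler_wpM2l h0 (hmean_lel u0 v0).
have hv := ler_wpM2l h0 (hmean_ler u0 v0).
case: lpm => -[hlp hlm].
  apply: le_trans hu _; rewrite mulrC (le_trans (ler_wpM2l (ltW u0) hlp))//.
  by rewrite lerDl mulr_ge0// ltW.
apply: le_trans hv _; rewrite mulrC (le_trans (ler_wpM2l (ltW v0) hlm))//.
by rewrite lerDr mulr_ge0// ltW.
Qed.

Lemma hard_best_plus :
  (1 / 2 + eps) * DCG R 1%g (hard true) + (1 - (1 / 2 + eps)) * DCG R 1%g (hard false)
  = hard_best.
Proof.
rewrite !DCG_hard invg1 !perm1 /= item1E item2E /hard_best.
by field.
Qed.

Lemma hard_best_minus (s := tperm item1 item2) :
  (1 / 2 - eps) * DCG R s (hard true) + (1 - (1 / 2 - eps)) * DCG R s (hard false)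
  = hard_best.
Proof.
rewrite !DCG_hard tpermV tpermL tpermR tpermD ?item1E ?item2E /hard_best.
- by field.
- by apply/eqP => /(congr1 val)/=; rewrite item1E.
- by apply/eqP => /(congr1 val)/=; rewrite item2E.
Qed.

End hard_instance.

(** * Regret bounds and the rate *)

Lemma regret_lower_bound (R : realType) (m n : nat) (L : learner R m n) (T : nat)
    (eps : R) :
  (2 <= m)%N -> (1 <= n)%N -> 0 < eps -> eps <= 1 / 4 ->
  let d := discount R in let h := 2 * (d 1 - d 2) * eps in
  h * (1 + 4 * T%:R * eps ^+ 2) <= d 0 - d 1 ->
  T%:R * h / 4 <= worst_case_regret L T.
Proof.
move=> m2 n1 e0 e4 d h hT.
set W := worst_case_regret L T; pose rel := @hard m n.
have ranks (s : 'S_m.+1) (i j : 'I_m.+1) : i != j :> nat ->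
    (s^-1)%g i != (s^-1)%g j :> nat.
  by apply: contraNneq => /val_inj/perm_inj ->.
have n01 : (ord0 : 'I_m.+1) != item1 m :> nat by rewrite item1E.
have n02 : (ord0 : 'I_m.+1) != item2 m :> nat by rewrite item2E.
have n12 : item1 m != item2 m :> nat by rewrite item1E// item2E.
have d12 : 0 < d 1 - d 2 by rewrite subr_gt0 discount_lt.
have h0 : 0 <= h by rewrite !mulr_ge0// ltW.
have e2 : eps < 1 / 2 by lra.
have eps0 := ltW e0.
(* For a fixed seed the learner is deterministic. Equal prior weights [u = v = 1] give the initial
   potential 1/2. *)
have bayes (f : seq 'I_n.+1 -> 'S_m.+1) : T%:R * h * (1 / 2) <=
    (T%:R * hard_best eps - avg rel (1 / 2 + eps) T (gain R T f)) +
    (T%:R * hard_best eps - avg rel (1 / 2 - eps) T (gain R T f)).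
  have := @bayes_regret R m n rel eps (hard_best eps) ((d 0 - d 1) / 4) h
    e0 e2 h0 _ _ _ T T f 1 1 (leqnn _) _ ltr01 ltr01.
  have -> : hmean 1 1 = 1 / 2 :> R by rewrite /hmean; field.
  rewrite !(mul1r (_ - _)) => H; apply: H.
  - by rewrite /rel !ffunE eqxx.
  - move=> s s0.
    have rk0 : (0 < (s^-1)%g ord0)%N.
      rewrite lt0n; apply: contraNneq s0 => sV0.
      have sV : (s^-1)%g ord0 = ord0 by exact: val_inj.
      by rewrite -{1}sV permKV.
    rewrite /mean_loss !DCG_hard//; split.
      by apply: hard_loss_explore => //; [exact: ranks..|left].
    by apply: hard_loss_explore => //; [exact: ranks..|right].
  - move=> s u v /negPn/eqP s0 u0 v0.
    have sV : (s^-1)%g ord0 = ord0 by rewrite -{1}s0 permK.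
    rewrite /mean_loss !DCG_hard// sV.
    have r0 (i : 'I_m.+1) : (ord0 : 'I_m.+1) != i :> nat -> (s^-1)%g i != 0%N :> nat.
      by move/(ranks s); rewrite sV eq_sym.
    by apply: hard_loss_exploit => //; [exact: r0|exact: ranks|exact: r0].
  - by rewrite [leRHS]mulrC divfK.
have p01 : 0 <= 1 / 2 + eps <= 1 by apply/andP; split; lra.
have q01 : 0 <= 1 / 2 - eps <= 1 by apply/andP; split; lra.
(* If [s] attains [hard_best] under the bias [p], comparing with [s] on each toss sequence bounds
   the mean regret by [W]. *)
have fixed p (s : 'S_m.+1) : 0 <= p <= 1 ->
    p * DCG R s (rel true) + (1 - p) * DCG R s (rel false) = hard_best eps ->
    T%:R * hard_best eps - avg rel p T (fun r => expected_gain L r T) <= W.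
  move=> p0 <-; rewrite -avg_gain_cst -avgB avg_le_cst// => r.
  apply: le_trans (worst_case_regret_ge L r T); rewrite lerD2r gainE.
  exact: best_fixed_gain_ge.
have Wp := fixed _ _ p01 (hard_best_plus eps m2 n1).
have Wm := fixed _ _ q01 (hard_best_minus eps m2 n1).
have [Xp Ep] := avg_expected_gain rel L T (1 / 2 + eps) T id.
have [Xm Em] := avg_expected_gain rel L T (1 / 2 - eps) T id.
set Yp := (fun w => avg _ _ _ _) in Xp Ep; set Ym := (fun w => avg _ _ _ _) in Xm Em.
(* The bound for each seed is integrated over the seeds. *)
have : (avg rel (1 / 2 + eps) T (fun r => expected_gain L r T) +
        avg rel (1 / 2 - eps) T (fun r => expected_gain L r T))%R
    <= T%:R * hard_best eps + T%:R * hard_best eps - T%:R * h / 2.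
  rewrite -lee_fin EFinD -Ep -Em -expectationD//.
  rewrite -(expectation_cst (seed_law L)) unlock.
  apply: le_integral => //.
  - by apply/Lfun1_integrable; rewrite rpredD.
  - by apply/Lfun1_integrable; rewrite Lfun_cst.
  move=> w _ /=; rewrite lee_fin.
  have := bayes (fun h => play h w).
  have eg p : avg rel p T (fun r => total_gain r T w) =
      avg rel p T (gain R T (fun h => play h w)).
    by congr (avg _ _ _ _); apply/funext => r; rewrite total_gainE.
  rewrite /Yp /Ym !eg.
  lra.
lra.
Qed.

(** With [gamma = x^-1] and [lambda = x ^+ 2], the term [lambda / 2], the exploration cost and the
    potential growth are all of order [x ^+ 2]. *)
Lemma regret_upper_bound (R : realType) (m n T : nat) (x : R) :
  1 <= x -> T%:R = x ^+ 3 ->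
  let D := m.+1%:R * 2 ^+ n in
  exists L : learner R m n, worst_case_regret L T <=
    (1 / 2 + D + #|'S_m.+1|%:R * D ^+ 2 / 2) * x ^+ 2.
Proof.
move=> x1 Tx D.
have x0 : 0 < x by apply: lt_le_trans x1.
have g0 : 0 < x^-1 by rewrite invr_gt0.
have g1 : x^-1 <= 1 by rewrite invf_le1.
have l0 : 0 < x ^+ 2 by rewrite exprn_gt0.
have [L LE] := behavioural_learner (@rm_act m) (@rm_update R m n x^-1)
  (rm_law_ge0 g0 g1) (rm_law_sum x^-1) T (fun=> 0).
exists L; apply: ge_sup.
  by exists (expected_regret L (fun=> [ffun=> ord0]) T), (fun=> [ffun=> ord0]).
move=> _ [r _ <-]; rewrite /expected_regret LE lerBlDr.
have ub (s : 'S_m.+1) : \sum_(t < T) DCG R s (r t) <=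
    (1 / 2 + D + #|'S_m.+1|%:R * D ^+ 2 / 2) * x ^+ 2 +
    rm_value x^-1 T (fun=> 0) r.
  have := rm_value_ge g0 g1 l0 T (fun=> 0) r s.
  have -> : potential (fun _ : 'S_m.+1 => 0 : R) = 0.
    by rewrite /potential big1// => s' _; rewrite /pos_part maxxx expr0n.
  have -> : T%:R * round_cost m n x^-1 (x ^+ 2) =
      (D + #|'S_m.+1|%:R * D ^+ 2 / 2) * x ^+ 2.
    rewrite Tx /round_cost -/D; move: #|_|%:R D => N D'.
    by field; rewrite gt_eqF.
  rewrite mul0r addr0 subr0.
  lra.
apply: best_fixed_gain_le => //.
(* The maximum has default value 0, so the bound must also be shown nonnegative. *)
apply: le_trans (ub 1%g); rewrite sumr_ge0// => t _; exact: DCG_ge0.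
Qed.

Theorem mainTheorem10 (R : realType) (m n : nat)
    (hm : (3 <= m.+1)%N) (hn : (1 <= n)%N) :
  (minimax_regret R m n : nat -> R) =Theta_\oo
    (fun T : nat => (T%:R : R) `^ (2%:R / 3%:R)).
Proof.
pose d := discount R.
have d01 : d 1 < d 0 by exact: discount_lt.
have d12 : d 2 < d 1 by exact: discount_lt.
have d2 : 0 < d 2 by exact: discount_gt0.
have d0 : d 0 = 1 by exact: discount0.
pose D : R := m.+1%:R * 2 ^+ n.
pose C := 1 / 2 + D + #|'S_m.+1|%:R * D ^+ 2 / 2.
pose c := (d 0 - d 1) / 4.
(* This is [T%:R * h / 4] divided by [x ^+ 2], for [eps = c / x] and [T = x ^+ 3]. *)
pose c' := (d 1 - d 2) * c / 2.
have c0 : 0 < c by rewrite /c; lra.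
have c4 : c <= 1 / 4 by rewrite /c; lra.
have c'0 : 0 < c' by rewrite divr_gt0 ?mulr_gt0// subr_gt0.
have D0 : 0 < D by rewrite mulr_gt0 ?exprn_gt0.
have C0 : 0 < C by rewrite addr_gt0 ?addr_gt0 ?divr_gt0 ?mulr_gt0 ?ltr0n ?card_Sn ?fact_gt0 ?exprn_gt0.
rewrite eqThetaE qualifE; apply/asboolP; exists (c', C); first by rewrite /= c'0.
near=> T.
have T1 : (1 <= T)%N by near: T; exact: nbhs_infty_ge.
pose x : R := T%:R `^ (1 / 3).
have x1 : 1 <= x.
  by rewrite -[leLHS](powRr0 T%:R) ler_powR ?ler1n// divr_ge0.
have x0 : 0 < x by apply: lt_le_trans x1.
have Tx : T%:R = x ^+ 3.
  by rewrite /x -powR_mulrn ?powR_ge0// -powRrM divfK ?pnatr_eq0// powRr1.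
have -> : T%:R `^ (2%:R / 3%:R) = x ^+ 2 :> R.
  by rewrite /x -powR_mulrn ?powR_ge0// -powRrM; congr (_ `^ _); field.
have lower (L : learner R m n) : c' * x ^+ 2 <= worst_case_regret L T.
  have e0 : 0 < c / x by rewrite divr_gt0.
  have e4 : c / x <= 1 / 4 by rewrite (le_trans _ c4)// ler_pdivrMr// ler_peMr// ltW.
  have := @regret_lower_bound R m n L T (c / x) hm hn e0 e4.
  rewrite -/d => /(_ _)/(le_trans _); apply.
    rewrite Tx /c' le_eqVlt; apply/orP; left; apply/eqP.
    by field; rewrite gt_eqF.
  rewrite Tx.
  (* The order [x^-1] of [eps] keeps the last factor bounded: it is at most 2, and
     [2 * (d 1 - d 2) <= 2], so the product is at most [4 * c = d 0 - d 1]. *)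
  have -> : 2 * (d 1 - d 2) * (c / x) * (1 + 4 * x ^+ 3 * (c / x) ^+ 2)
     = 2 * (d 1 - d 2) * c * (x^-1 + 4 * c ^+ 2) by field; rewrite gt_eqF.
  have -> : d 0 - d 1 = 4 * c by rewrite /c; field.
  have xi : x^-1 <= 1 by rewrite invf_le1.
  have xi0 : 0 < x^-1 by rewrite invr_gt0.
  have cc : 4 * c ^+ 2 <= 1 by nra.
  have k2 : 2 * (d 1 - d 2) <= 2 by lra.
  have := ler_wpM2r (ltW c0) k2 => kc.
  have s2 : 0 <= x^-1 + 4 * c ^+ 2 <= 2.
    have cc0 : 0 <= 4 * c ^+ 2 by rewrite mulr_ge0 ?sqr_ge0.
    by apply/andP; split; lra.
  have [s20 s22] := andP s2.
  apply: (le_trans (ler_wpM2r s20 kc)).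
  have c20 : 0 <= 2 * c by rewrite mulr_ge0// ltW.
  apply: (le_trans (ler_wpM2l c20 s22)); lra.
have x20 : 0 < x ^+ 2 by rewrite exprn_gt0.
have [L LC] := @regret_upper_bound R m n T x x1 Tx.
have lb : c' * x ^+ 2 <= minimax_regret R m n T.
  apply: lb_le_inf; first by exists (worst_case_regret L T), L.
  by move=> _ [L' ->].
have c'x0 : 0 < c' * x ^+ 2 by rewrite mulr_gt0.
rewrite /= (gtr0_norm x20) gtr0_norm; last exact: lt_le_trans lb.
split=> //; apply: le_trans LC; apply: ge_inf; last by exists L.
by exists (c' * x ^+ 2) => _ [L' ->].
Unshelve. all: by end_near.
Qed.
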